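(* Let $\mathcal{N}$ be a nest, let $n\ge2$ and $p\ge1$ be integers, and let $q=(n^p-1)/(n-1)$. Suppose that $\mathcal{N}$ contains a chain of elements $N_0<N_1<\dots<N_q$ such that $$\dim(N_j\ominus N_{j-1})\ge\dim(N_{j+1}\ominus N_j)\quad\text{for } 1\le j<q.$$ Then $$\rho_n(\mathcal{T}(\mathcal{N}),t)\ge(1-2t)^{p-1}t^{-p}\ge2^p\quad\text{for all } 0<t\le 1/4.$$
   Context: A nest $\mathcal{N}$ is a complete chain (with respect to inclusion) of closed subspaces of a Hilbert space $\mathcal{H}$ containing $\{0\}$ and $\mathcal{H}$. The nest algebra $\mathcal{T}(\mathcal{N})$ is the algebra of all $T\in\mathcal{B}(\mathcal{H})$ with $TN\subset N$ for every $N\in\mathcal{N}$. For a unital operator algebra $\mathfrak{A}\subset\mathcal{B}(\mathcal{H})$, $\mathcal{R}_n(\mathfrak{A})$ is the space of $1\times n$ rows with entries in $\mathfrak{A}$, normed as a subspace of $\mathcal{B}(\mathcal{H}^{(n)},\mathcal{H})$, and $\mathcal{C}_n(\mathfrak{A})$ is the space of $n\times1$ columns, normed as a subspace of $\mathcal{B}(\mathcal{H},\mathcal{H}^{(n)})$, where $\mathcal{H}^{(n)}$ is the direct sum of $n$ copies of $\mathcal{H}$. For $A\in\mathcal{R}_n(\mathfrak{A})$ and $t>0$ let $$\rho_n(A,t)=\inf\{\|C\|: C\in\mathcal{C}_n(\mathfrak{A}),\ \exists B\in\mathcal{R}_n(\mathfrak{A})\text{ with }\|A-B\|<t\text{ and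 }BC=I\},$$ with $\inf\emptyset=+\infty$, and for $0<t\le1$ let $$\rho_n(\mathfrak{A},t)=\sup\{\rho_n(A,t):A\in\mathcal{R}_n(\mathfrak{A}),\ \|A\|\le1\}.$$ *)

(* Defs.v *)
From HB Require Import structures.
From mathcomp Require Import all_boot all_order all_algebra.
From mathcomp Require Import all_classical all_reals all_analysis.
From mathcomp Require Import complex.

Set Implicit Arguments.
Unset Strict Implicit.
Unset Printing Implicit Defensive.

Import Order.TTheory GRing.Theory Num.Theory.
Import numFieldNormedType.Exports.

Local Open Scope classical_set_scope.
Local Open Scope ring_scope.
Local Open Scope complex_scope.

(* A complex Hilbert space is a complete normed space [H] over [R[i]] together
   with [dot : {dot H for Num.conj}] (linear in the first argument, conjugate
   linear in the second) such that [dot x x = `|x| ^+ 2] for all [x]. *)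

Section HilbertSpace.
Context {R : realType} {H : completeNormedModType R[i]}.

Definition closed_subspace (M : set H) : Prop :=
  [/\ M 0, forall (a : R[i]) (x y : H), M x -> M y -> M (a *: x + y) & closed M].

Definition closed_span (A : set H) : set H :=
  \bigcap_(M in [set M | closed_subspace M /\ A `<=` M]) M.

Definition ominus (dot : {dot H for Num.conj}) (M N : set H) : set H :=
  [set x | M x /\ forall y, N y -> dot x y = 0].

Definition orthonormal_basis (dot : {dot H for Num.conj}) (M E : set H) : Prop :=
  [/\ E `<=` M,
      forall e f, E e -> E f -> dot e f = (e == f)%:R
    & closed_span E = M].

(* The Hilbert dimension, which may be infinite, is the cardinality of an
   orthonormal basis; it depends neither on the basis of [M] nor on that of
   [M']. *)
Definition hdim_ge (dot : {dot H for Num.conj}) (M M' : set H) : Prop :=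
  exists E E' : set H,
    [/\ orthonormal_basis dot M E, orthonormal_basis dot M' E' & (E' #<= E)%card].

(* Completeness is with respect to the lattice of closed subspaces; the empty
   family has meet [setT] and join [[set 0]]. *)
Definition nest (NN : set (set H)) : Prop :=
  [/\ forall M, NN M -> closed_subspace M,
      forall M N, NN M -> NN N -> M `<=` N \/ N `<=` M,
      NN [set 0],
      NN setT
    & forall F : set (set H), F `<=` NN ->
        NN (\bigcap_(M in F) M) /\ NN (closed_span (\bigcup_(M in F) M))].

Definition nest_algebra (NN : set (set H)) : set (H -> H) :=
  [set T | [/\ linear T, continuous T & forall N, NN N -> T @` N `<=` N]].

(* The norm of [H] takes its values in [R[i]]; [hnorm] is its real part. *)
Definition hnorm (x : H) : R := complex.Re `|x|.

(* The norm of the Hilbert space direct sum of [n] copies of [H]. *)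
Definition hnormn (n : nat) (x : 'I_n -> H) : R :=
  Num.sqrt (\sum_(i < n) hnorm (x i) ^+ 2).

Definition opnorm (V W : Type) (nV : V -> R) (nW : W -> R) (T : V -> W) : \bar R :=
  ereal_sup [set (nW (T x))%:E | x in [set x | nV x <= 1]].

Definition row_op (n : nat) (A : 'I_n -> H -> H) (x : 'I_n -> H) : H :=
  \sum_(i < n) A i (x i).

Definition col_op (n : nat) (C : 'I_n -> H -> H) (x : H) : 'I_n -> H :=
  fun i => C i x.

Definition row_norm (n : nat) (A : 'I_n -> H -> H) : \bar R :=
  opnorm (@hnormn n) hnorm (row_op A).

Definition col_norm (n : nat) (C : 'I_n -> H -> H) : \bar R :=
  opnorm hnorm (@hnormn n) (col_op C).

(* [entries_in AA] is both the set of rows and the set of columns of length [n]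
   with entries in [AA]. *)
Definition entries_in (n : nat) (AA : set (H -> H)) : set ('I_n -> H -> H) :=
  [set A | forall i, AA (A i)].

Definition rho_row (n : nat) (AA : set (H -> H)) (A : 'I_n -> H -> H) (t : R) :
    \bar R :=
  ereal_inf [set col_norm C | C in [set C | entries_in AA C /\
    exists B : 'I_n -> H -> H,
      [/\ entries_in AA B,
          (row_norm (fun i x => A i x - B i x)%R < t%:E)%E
        & row_op B \o col_op C = id]]].

Definition rho (n : nat) (AA : set (H -> H)) (t : R) : \bar R :=
  ereal_sup [set rho_row AA A t | A in
    [set A : 'I_n -> H -> H | entries_in AA A /\ (row_norm A <= 1%:E)%E]].

End HilbertSpace.

(* Main.v *)
(** For [0 <= v < q] let [E_v] be the orthocomplement of [N_(q - v - 1)] in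
    [N_(q - v)].  Regard the [E_v] as the vertices of the complete [n]-ary tree
    of depth [p - 1] with root [E_0], numbered level by level.  The
    dimension hypothesis gives isometries of each vertex into its [n] children;
    they are the nonzero blocks of the entries of a row [A] over the nest
    algebra, which maps the part of [H^(n)] at depth [k] isometrically into
    depth [k + 1], since different pairs (vertex, entry) have different images.

    If [BC = I] with [|A - B| < t] and [x] is a unit vector of [E_0], let [b_k]
    be the squared norm of the part of [Cx] at depth [k].  As [B] and [C] are
    block triangular, the components of [BCx = x] at depths [0] and [k + 1] give
    [1 <= t^2 b_0] and [b_k <= t^2 (b_0 + ... + b_(k+1))].  For [t <= 1/4] this
    forces [b_(k+1) >= ((1 - 2t)/t)^2 b_k], whence the bound on [|C|]. *)

Require Import Defs.
From HB Require Import structures.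
From mathcomp Require Import all_boot all_order all_algebra.
From mathcomp Require Import all_classical all_reals all_analysis.
From mathcomp Require Import complex.
From mathcomp Require Import ring lra zify.

Set Implicit Arguments.
Unset Strict Implicit.
Unset Printing Implicit Defensive.

Import Order.TTheory GRing.Theory Num.Theory.
Import numFieldNormedType.Exports.

Local Open Scope classical_set_scope.
Local Open Scope ring_scope.
Local Open Scope complex_scope.

(** * Lipschitz maps, the scalar recursion and the level sizes of the tree *)

Lemma lipschitz_continuous (K : numFieldType) (V W : normedModType K)
    (f : V -> W) (k : K) : 0 <= k ->
  (forall x y, `|f x - f y| <= k * `|x - y|) -> continuous f.
Proof.
move=> k0 fk x; apply/cvgrPdist_lt => e e0.
(* The constant [k] may vanish, so [k + 1] is used as the divisor. *)
have k1 : 0 < k + 1 by rewrite ltr_wpDl.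
near=> y; apply: (@le_lt_trans _ _ ((k + 1) * `|x - y|)).
  by apply: le_trans (fk x y) _; rewrite ler_wpM2r// lerDl.
rewrite mulrC -ltr_pdivlMr//.
by near: y; apply: cvgr_dist_lt => //; rewrite divr_gt0.
Unshelve. all: by end_near. Qed.

(** The induction also carries $S_k\le 2b_k$, where $S_k=b_0+\dots+b_k$. With $u=1/t\ge4$ the
    recursion gives $b_{k+1}\ge u^2b_k-S_k\ge(u^2-2)b_k\ge(u-2)^2b_k$. As $(u-2)^2\ge4$, this yields
    $S_{k+1}\le 2b_k+b_{k+1}\le 2b_{k+1}$. *)
Lemma geometric_growth (R : realFieldType) (b : nat -> R) (t : R) (p : nat) :
  0 < t -> t <= 1 / 4 -> (forall k, 0 <= b k) ->
  1 <= t ^+ 2 * b 0%N ->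
  (forall k, (k.+1 < p)%N -> b k <= t ^+ 2 * \sum_(j < k.+2) b j) ->
  forall k, (k < p)%N -> ((1 - 2 * t) ^+ k * t ^- k.+1) ^+ 2 <= b k.
Proof.
move=> t0 t4 b0 b0t bS.
have tV : 4 <= t^-1 by rewrite -[4]invrK lef_pV2 ?posrE//; lra.
have step k : (k.+1 < p)%N -> \sum_(j < k.+1) b j <= 2 * b k ->
    ((1 - 2 * t) / t) ^+ 2 * b k <= b k.+1.
  move=> kp sk; have := bS k kp; rewrite big_ord_recr /=.
  rewrite -ler_pdivrMl ?exprn_gt0// -exprVn.
  have -> : (1 - 2 * t) / t = t^-1 - 2 by rewrite mulrBl mul1r mulfK// gt_eqF.
  have := b0 k; move: t^-1 tV sk => u u4 sk bk h.
  by nra.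
have main k : (k < p)%N -> ((1 - 2 * t) ^+ k * t ^- k.+1) ^+ 2 <= b k /\
    \sum_(j < k.+1) b j <= 2 * b k.
  elim: k => [_|k IH kp].
    rewrite big_ord1 expr0 mul1r -exprVn expr1; split; last by have := b0 0%N;
      lra.
    by rewrite exprVn -[_^-1]mulr1 ler_pdivrMl// exprn_gt0.
  have [IH1 IH2] := IH (ltnW kp); have st := step k kp IH2; split.
    apply: le_trans st; rewrite [_ ^+ k.+1]exprS [t ^+ k.+2]exprS invfM
      mulrACA exprMn.
    by rewrite ler_wpM2l ?sqr_ge0.
  rewrite big_ord_recr /=.
  have := b0 k; move: st.
  have -> : (1 - 2 * t) / t = t^-1 - 2 by rewrite mulrBl mul1r mulfK// gt_eqF.
  move: t^-1 tV => u u4 st bk; have : 4 <= (u - 2) ^+ 2 by nra.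
  by nra.
by move=> k kp; case: (main k kp).
Qed.

(** This counts the vertices of depth less than [k], so it is also the number of the first vertex of
    depth [k]. *)
Definition level n k := (\sum_(j < k) n ^ j)%N.

Lemma level0 n : level n 0 = 0%N.
Proof. exact: big_ord0. Qed.

Lemma levelS n k : level n k.+1 = (n * level n k).+1.
Proof.
rewrite /level big_ord_recl expn0 add1n big_distrr /=; congr _.+1.
by apply: eq_bigr => j _; rewrite expnS.
Qed.

Lemma level_le n k l : (k <= l)%N -> (level n k <= level n l)%N.
Proof.
move=> /subnK <-; elim: (l - k)%N => // d IH.
by rewrite addSn /level big_ord_recr /= (leq_trans IH)// leq_addr.
Qed.

(** * Consequences of linearity for bare functions *)

Section LinearMaps.
Variables (K : pzRingType) (U V : lmodType K) (T : U -> V).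
Hypothesis linT : linear T.

Lemma linear_map0 : T 0 = 0.
Proof. by have := linT (-1) 0 0; rewrite !scaler0 addr0 scaleN1r addNr. Qed.

Lemma linear_mapD x y : T (x + y) = T x + T y.
Proof. by have := linT 1 x y; rewrite !scale1r. Qed.

Lemma linear_mapB x y : T (x - y) = T x - T y.
Proof. by rewrite addrC -scaleN1r linT scaleN1r addrC. Qed.

Lemma linear_map_sum (I : Type) (r : seq I) (P : pred I) (f : I -> U) :
  T (\sum_(i <- r | P i) f i) = \sum_(i <- r | P i) T (f i).
Proof. by apply: (big_morph T); [exact: linear_mapD|exact: linear_map0]. Qed.

End LinearMaps.

(** * Real-valued norm, closed subspaces and a Cauchy criterion *)

Section HilbertSpaceTheory.
Context {R : realType} {H : completeNormedModType R[i]}.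
Implicit Types (x y z : H) (M : set H).

Lemma hnormE x : (hnorm x)%:C = `|x|.
Proof. by apply: RRe_real; rewrite ger0_real. Qed.

Lemma hnorm_ge0 x : 0 <= hnorm x.
Proof. by rewrite -ler0c hnormE. Qed.

Lemma hnorm0 : hnorm (0 : H) = 0.
Proof. by apply: complexI; rewrite hnormE normr0. Qed.

Lemma hnorm0_eq0 x : hnorm x = 0 -> x = 0.
Proof. by move=> x0; apply/eqP; rewrite -normr_eq0 -hnormE x0. Qed.

Lemma normr_real_complex (r : R) : `|r%:C| = `|r|%:C.
Proof. by rewrite normc_def /= expr0n addr0 sqrtr_sqr. Qed.

Lemma hnormZr (r : R) x : hnorm (r%:C *: x) = `|r| * hnorm x.
Proof.
by apply: complexI; rewrite rmorphM /= !hnormE normrZ normr_real_complex.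
Qed.

Lemma hnorm_continuous : continuous (@hnorm R H).
Proof.
move=> x; apply/cvgrPdist_lt => e e0.
have e0' : 0 < e%:C by rewrite ltcR.
near=> y; rewrite -ltcR -normr_real_complex rmorphB /= !hnormE.
apply: le_lt_trans (ler_dist_dist _ _) _.
by near: y; apply: cvgr_dist_lt.
Unshelve. all: by end_near. Qed.

Lemma hnormN x : hnorm (- x) = hnorm x.
Proof. by rewrite /hnorm normrN. Qed.

Section ClosedSubspace.
Variables (M : set H) (cM : closed_subspace M).

Lemma csub0 : M 0. Proof. by case: cM. Qed.

Lemma csubP (a : R[i]) x y : M x -> M y -> M (a *: x + y).
Proof. by case: cM => _ + _; exact. Qed.

Lemma csubZ (a : R[i]) x : M x -> M (a *: x).
Proof. by move=> Mx; rewrite -[_ *: _]addr0; apply: csubP => //;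
  exact: csub0. Qed.

Lemma csubD x y : M x -> M y -> M (x + y).
Proof. by move=> Mx My; rewrite -[x]scale1r; exact: csubP. Qed.

Lemma csubB x y : M x -> M y -> M (x - y).
Proof. by move=> Mx My; rewrite addrC -scaleN1r; exact: csubP. Qed.

Lemma csub_sum (I : Type) (r : seq I) (P : pred I) (f : I -> H) :
  (forall i, P i -> M (f i)) -> M (\sum_(i <- r | P i) f i).
Proof. by move=> Mf; elim/big_ind: _ => //; [exact: csub0|exact: csubD]. Qed.

End ClosedSubspace.

(** Parallelogram estimates produce bounds of this shape, both for minimising sequences and for the
    domain of an extended isometry. *)
Lemma cauchy_seq_cvg (u : nat -> H) (c : R) : 0 < c ->
  (forall k l, hnorm (u k - u l) ^+ 2 <= c * (k.+1%:R^-1 + l.+1%:R^-1)) ->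
  exists y, u @ \oo --> y.
Proof.
move=> c0 uc; suff /cvg_ex : cvg (u @ \oo) by [].
apply: cauchy_cvg; apply/cauchy_ballP => e e0.
have [r er] : exists r, e = r%:C by apply/complex_realP; rewrite gtr0_real.
have r0 : 0 < r by move: e0; rewrite er ltcR.
have rc : 0 < r ^+ 2 / (2 * c) by rewrite divr_gt0 ?mulr_gt0 ?exprn_gt0.
have small := near_infty_natSinv_lt (PosNum rc).
rewrite near_map2; near=> k l; rewrite -ball_normE /= -hnormE er ltcR.
rewrite -(ltr_pXn2r (n:=2)) ?nnegrE ?hnorm_ge0 ?(ltW r0)//.
apply: le_lt_trans (uc k l) _.
have -> : r ^+ 2 = c * (r ^+ 2 / (2 * c) + r ^+ 2 / (2 * c)).
  by field; rewrite (gt_eqF c0).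
by rewrite ltr_pM2l// ltrD//; [near: k|near: l].
Unshelve. all: by end_near. Qed.

(** * Norm estimates for rows *)

Section Rows.
Variable n : nat.
Implicit Type D : 'I_n -> H -> H.

Lemma hnormn_sqr (z : 'I_n -> H) : hnormn z ^+ 2 = \sum_(i < n) hnorm (z i) ^+
  2.
Proof. by rewrite sqr_sqrtr// sumr_ge0// => i _; rewrite sqr_ge0. Qed.

(** The row norm is a supremum over the unit ball, so [z] is rescaled to norm 1. A [z] of norm 0
    cannot be rescaled and is treated first. *)
Lemma row_norm_bound D (t : R) (z : 'I_n -> H) : (forall i, linear (D i)) ->
  (row_norm D < t%:E)%E ->
  hnorm (row_op D z) ^+ 2 <= t ^+ 2 * \sum_(i < n) hnorm (z i) ^+ 2.
Proof.
move=> lD Dt.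
have DZ (a : R[i]) : row_op D (fun i => a *: z i) = a *: row_op D z.
  rewrite /row_op scaler_sumr; apply: eq_bigr => i _.
  by have := lD i a (z i) 0; rewrite (linear_map0 (lD i)) !addr0.
have Dle (y : 'I_n -> H) : hnormn y <= 1 -> hnorm (row_op D y) < t.
  move=> y1; rewrite -lte_fin; apply: le_lt_trans Dt.
  by apply: ereal_sup_ubound; exists y.
rewrite -hnormn_sqr -exprMn; have := sqrtr_ge0 (\sum_(i < n) hnorm (z i) ^+ 2).
rewrite -/(hnormn z) le_eqVlt => /predU1P[z0|z0].
  have -> : row_op D z = 0.
    have zi i : z i = 0.
      apply: hnorm0_eq0; apply/eqP; rewrite -sqrf_eq0.
      move: (hnormn_sqr z); rewrite -z0 expr0n /= => /esym/eqP.
      rewrite psumr_eq0 => [/allP/(_ i)|j _]; last exact: sqr_ge0.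
      by rewrite mem_index_enum => /(_ isT).
    rewrite -[RHS](scale0r (row_op D z)) -DZ; congr row_op.
    by apply/funext => i; rewrite scale0r zi.
  by rewrite -z0 hnorm0 mulr0.
have s1 : hnormn (fun i => (hnormn z)^-1%:C *: z i) <= 1.
  rewrite -(ler_pXn2r (n:=2)) ?nnegrE ?sqrtr_ge0//.
  rewrite hnormn_sqr.
  under eq_bigr do rewrite hnormZr exprMn.
  rewrite -mulr_sumr -hnormn_sqr real_normK ?num_real//.
  by rewrite -exprMn mulVf ?gt_eqF// expr1n.
have := Dle _ s1; rewrite DZ hnormZr ger0_norm; last by rewrite invr_ge0 ltW.
rewrite ltr_pdivrMl// mulrC => le1.
have t0 : 0 <= t * hnormn z by apply: le_trans (ltW le1); exact: hnorm_ge0.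
by rewrite ler_pXn2r ?nnegrE ?hnorm_ge0// ltW.
Qed.

End Rows.

(** * Inner product and orthogonal projection *)

Section Inner.
Variables (dot : {dot H for Num.conj}) (dotE : forall x : H, dot x x = `|x| ^+
  2).

Lemma dotxx x : dot x x = (hnorm x ^+ 2)%:C.
Proof. by rewrite dotE -hnormE rmorphXn. Qed.

Lemma dotC x y : dot x y = (dot y x)^*%R.
Proof. by rewrite hermC mul1r. Qed.

Lemma dot_eq0C x y : dot x y = 0 -> dot y x = 0.
Proof. by move=> xy; rewrite dotC xy rmorph0. Qed.

Lemma pythagoras x y :
  dot x y = 0 -> hnorm (x + y) ^+ 2 = hnorm x ^+ 2 + hnorm y ^+ 2.
Proof.
move=> xy; have : dot (x + y) (x + y) = dot x x + dot y y by rewrite hnormDd.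
by rewrite !dotxx -rmorphD => /complexI.
Qed.

Lemma parallelogram x y : hnorm (x + y) ^+ 2 + hnorm (x - y) ^+ 2 =
  2 * (hnorm x ^+ 2 + hnorm y ^+ 2).
Proof.
have : dot (x + y) (x + y) + dot (x - y) (x - y) =
    2%:C * (dot x x + dot y y).
  by rewrite dnormD dnormB rmorphD rmorph1 /=; ring.
by rewrite !dotxx -!rmorphD -rmorphM => /complexI.
Qed.

(** Positivity of the left side is the Cauchy-Schwarz inequality. The amount subtracted on the right
    forces orthogonality at a point of minimal distance. *)
Lemma dnorm_sub_proj x z : z != 0 ->
  dot (x - (dot x z / dot z z) *: z) (x - (dot x z / dot z z) *: z) =
  dot x x - `|dot x z| ^+ 2 / dot z z.
Proof.
move=> z0; set a := _ / _.
have zz : dot z z != 0 by rewrite dnorm_eq0.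
have ez : dot (x - a *: z) z = 0.
  by rewrite linearBl linearZl_LR /= /a divfK// subrr.
rewrite linearBr /= linearZr_LR /= ez mulr0 subr0 linearBl linearZl_LR /=.
by rewrite /a [dot z x]dotC mulrAC normCK.
Qed.

Lemma CauchySchwarz_dot x y : `|dot x y| <= `|x| * `|y|.
Proof.
have [->|y0] := eqVneq y 0; first by rewrite linear0r !normr0 mulr0.
rewrite -(ler_pXn2r (n:=2)) ?nnegrE ?mulr_ge0//.
have y2 : 0 < `|y| ^+ 2 by rewrite exprn_gt0 // normr_gt0.
have := dnorm_ge0 dot (x - (dot x y / dot y y) *: y).
by rewrite dnorm_sub_proj// subr_ge0 !dotE ler_pdivrMr// exprMn.
Qed.

Lemma dot_continuous y : continuous (fun x => dot x y : R[i]^o).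
Proof.
apply: (@lipschitz_continuous _ _ _ _ `|y|) => // a b.
by rewrite -linearBl mulrC; exact: CauchySchwarz_dot.
Qed.

Lemma closed_subspace_orth y : closed_subspace [set x | dot x y = 0].
Proof.
split => /=; first exact: linear0l.
  by move=> a u v uy vy; rewrite linearPl /= uy vy mulr0 addr0.
apply: (@preimage_closed _ _ (fun x => dot x y : R[i]^o) [set 0]).
  by move=> x _; exact: dot_continuous.
exact/accessible_closed_set1/hausdorff_accessible/norm_hausdorff.
Qed.

Lemma closed_subspace_ominus M N :
  closed_subspace M -> closed_subspace (ominus dot M N).
Proof.
move=> [M0 MP cM]; split.
- by split => // y _; rewrite linear0l.
- move=> a x y [Mx xN] [My yN]; split; first exact: MP.
  by move=> z Nz; rewrite linearPl /= xN// yN// mulr0 addr0.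
- have -> : ominus dot M N = M `&` \bigcap_(y in N) [set x | dot x y = 0].
    by apply/seteqP; split.
  apply: closedI => //; apply: closed_bigI => y _.
  by case: (closed_subspace_orth y).
Qed.

(* A sequence in [M] minimising the distance to [x] is Cauchy by the
   parallelogram identity. *)
Lemma projection_theorem M x : closed_subspace M ->
  exists y, M y /\ forall z, M z -> dot (x - y) z = 0.
Proof.
move=> cM; pose D := [set hnorm (x - z) ^+ 2 | z in M].
have D_inf : has_inf D.
  split; first by exists (hnorm (x - 0) ^+ 2); exists 0 => //; exact: csub0 cM.
  by exists 0 => _ [z _ <-]; rewrite exprn_ge0// hnorm_ge0.
pose d := inf D.
have dD z : M z -> d <= hnorm (x - z) ^+ 2.
  by move=> Mz; apply: ge_inf; [case: D_inf|exists z].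
have /choice[u uP] (k : nat) :
    exists z, M z /\ hnorm (x - z) ^+ 2 < d + k.+1%:R^-1.
  have k0 : 0 < k.+1%:R^-1 :> R by rewrite invr_gt0.
  by have [_ [z Mz <-] zd] := inf_adherent k0 D_inf; exists z.
clearbody d; have [y uy] : exists y, u @ \oo --> y.
  apply: (@cauchy_seq_cvg _ 2) => // k l.
  have [[Mk dk] [Ml dl]] := (uP k, uP l).
  (* The midpoint of [u k] and [u l] lies in [M], so its squared distance to [x] is at least [d].
     The parallelogram identity then bounds $\|u_k-u_l\|^2$ by $2(2d+1/(k+1)+1/(l+1))-4d$, whence
     the constant 2. *)
  have := parallelogram (x - u l) (x - u k).
  have -> : x - u l - (x - u k) = u k - u l by rewrite opprB addrC subrKA.
  have -> : x - u l + (x - u k) = 2%:C *: (x - 2^-1%:C *: (u k + u l)).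
    rewrite scalerBr scalerA -rmorphM divff// rmorph1 scale1r.
    rewrite rmorphD rmorph1 scalerDl scale1r opprD.
    by rewrite [- u k - u l]addrC addrACA.
  rewrite hnormZr exprMn ger0_norm//.
  have := dD _ (csubZ cM 2^-1%:C (csubD cM Mk Ml)).
  move: dk dl; move: (hnorm _) (hnorm _) (hnorm _) (hnorm _) => a1 a2 a3 a4.
  move: d _^-1 _^-1 {dD uP} => e b1 b2 dk dl dh E; lra.
have My : M y.
  case: (cM) => _ _ clM; apply: (closed_cvg M clM _ _ uy).
  by near=> k; case: (uP k).
have yd : hnorm (x - y) ^+ 2 <= d.
  apply/ler_addgt0Pr => e e0.
  have xu : hnorm (x - u k) ^+ 2 @[k --> \oo] --> hnorm (x - y) ^+ 2.
    have xuy : x - u k @[k --> \oo] --> x - y.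
      exact: (cvgB (cvg_cst x) uy).
    have hxu : hnorm (x - u k) @[k --> \oo] --> hnorm (x - y).
      by apply: continuous_cvg xuy; exact: hnorm_continuous.
    exact: (cvgM hxu hxu).
  apply: (cvgr_to_le xu).
  have small := near_infty_natSinv_lt (PosNum e0).
  near=> k; apply: le_trans (ltW (proj2 (uP k))) _; rewrite lerD2l ltW//.
  by near: k.
exists y; split => // z Mz; have [->|z0] := eqVneq z 0; first exact: linear0r.
have zz : 0 < dot z z by rewrite dnorm_gt0.
set w := x - y; have := dnorm_sub_proj w z0; set a := _ / _ => aE.
(* Moving [y] by [a *: z] stays in [M] and cannot bring it closer to [x]. By [aE] it would do so
   unless [dot w z = 0]. *)
have : dot w w <= dot (w - a *: z) (w - a *: z).
  rewrite !dotxx lecR (le_trans yd)//.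
  have -> : w - a *: z = x - (a *: z + y) by rewrite opprD addrA addrAC.
  exact/dD/(csubP cM).
rewrite aE lerDl oppr_ge0 pmulr_lle0 ?invr_gt0//.
by rewrite -normrX normr_le0 sqrf_eq0 => /eqP.
Unshelve. all: by end_near. Qed.

Definition proj M x : H :=
  xget 0 [set y | M y /\ forall z, M z -> dot (x - y) z = 0].

Section Projection.
Variables (M : set H) (cM : closed_subspace M).

Lemma projP x : M (proj M x) /\ forall z, M z -> dot (x - proj M x) z = 0.
Proof.
have [y yP] := projection_theorem x cM.
by rewrite /proj; case: xgetP => // /(_ y).
Qed.

Lemma proj_in x : M (proj M x). Proof. by case: (projP x). Qed.

Lemma proj_orth x z : M z -> dot (x - proj M x) z = 0.
Proof. by case: (projP x) => _; exact. Qed.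

(** The vector [proj M x - y] lies in [M] and is orthogonal to [M], hence to itself. *)
Lemma proj_uniq x y :
  M y -> (forall z, M z -> dot (x - y) z = 0) -> proj M x = y.
Proof.
move=> My xy; have Md : M (proj M x - y) by apply: csubB => //; exact: proj_in.
apply/eqP; rewrite -subr_eq0 -(dnorm_eq0 dot).
have {1}-> : proj M x - y = (x - y) - (x - proj M x).
  by rewrite opprB [RHS]addrC subrKA.
by rewrite linearBl /= xy// proj_orth// subrr.
Qed.

Lemma proj_linear : linear (proj M).
Proof.
move=> a x y; apply: proj_uniq; first by apply: csubP => //; exact: proj_in.
move=> z Mz; rewrite opprD addrACA -scalerBr.
by rewrite linearPl /= !proj_orth// mulr0 addr0.
Qed.

Lemma proj_id x : M x -> proj M x = x.
Proof. by move=> Mx; apply: proj_uniq => // z _; rewrite subrr linear0l. Qed.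

Lemma proj_eq0 x : (forall z, M z -> dot x z = 0) -> proj M x = 0.
Proof. by move=> x0; apply: proj_uniq; [exact: csub0|rewrite subr0]. Qed.

Lemma hnorm_proj x :
  hnorm x ^+ 2 = hnorm (x - proj M x) ^+ 2 + hnorm (proj M x) ^+ 2.
Proof.
by rewrite -pythagoras ?subrK//; apply: proj_orth; exact: proj_in.
Qed.

End Projection.

(** * Closed spans and isometries between closed subspaces *)

Lemma closed_subspace_closed_span (E : set H) : closed_subspace (closed_span E).
Proof.
split.
- by move=> M [cM _]; exact: csub0.
- by move=> a x y Ex Ey M ME; apply: (csubP (proj1 ME)); [exact: Ex|exact: Ey].
- by apply: closed_bigI => M [[]].
Qed.

Lemma closed_span_sub (E M : set H) :
  closed_subspace M -> E `<=` M -> closed_span E `<=` M.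
Proof. by move=> cM EM x; apply. Qed.

(** [V] is a total function constrained only on [M]. Composition with [proj M] later makes it linear
    on all of [H]. *)
Definition isometry_on M M' (V : H -> H) : Prop :=
  [/\ forall x, M x -> M' (V x),
      forall (a : R[i]) x y, M x -> M y -> V (a *: x + y) = a *: V x + V y
    & forall x, M x -> hnorm (V x) = hnorm x].

Section IsometryExtension.
Variables (E : set H) (phi : H -> H).
Hypothesis phi_dot : forall e f, E e -> E f -> dot (phi e) (phi f) = dot e f.

(* The closed linear relation generated by the graph of [phi] on [E]; it turns
   out to be the graph of an isometry whose domain is complete. *)
Let G (g : H * H) : Prop := forall S : set (H * H),
  S 0 -> (forall (a : R[i]) g h, S g -> S h -> S (a *: g + h)) -> closed S ->
  (forall e, E e -> S (e, phi e)) -> S g.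

Let G0 : G 0. Proof. by move=> S S0 _ _ _; exact: S0. Qed.

Let GP (a : R[i]) g h : G g -> G h -> G (a *: g + h).
Proof.
by move=> Gg Gh S S0 SP cS SE;
  apply: (SP) (Gg S S0 SP cS SE) (Gh S S0 SP cS SE).
Qed.

Let GB g h : G g -> G h -> G (g - h).
Proof. by move=> Gg Gh; rewrite addrC -scaleN1r; exact: GP. Qed.

Let G_closed : closed (G : set (H * H)).
Proof.
move=> g Gg S S0 SP cS SE; apply: (cS) => B /Gg[h [Gh Bh]].
by exists h; split => //; exact: (Gh S S0 SP cS SE).
Qed.

Let closed_dot_eq (u v : H) : closed [set g : H * H | dot g.1 u = dot g.2 v].
Proof.
have -> : [set g : H * H | dot g.1 u = dot g.2 v] =
    (fun g : H * H => dot g.1 u - dot g.2 v : R[i]^o) @^-1` [set 0].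
  by apply/seteqP; split => g /=; [move=> ->; rewrite subrr|move/subr0_eq].
apply: preimage_closed.
  move=> g _; apply: cvgB.
    exact: (continuous_comp (@cvg_fst _ _ _ _ _) (@dot_continuous u _)).
  exact: (continuous_comp (@cvg_snd _ _ _ _ _) (@dot_continuous v _)).
exact/accessible_closed_set1/hausdorff_accessible/norm_hausdorff.
Qed.

Let G_dot_ind (u v : H) : (forall e, E e -> dot e u = dot (phi e) v) ->
  forall g, G g -> dot g.1 u = dot g.2 v.
Proof.
move=> Euv g Gg; apply: (Gg [set g | dot g.1 u = dot g.2 v]) => /=.
- by rewrite !linear0l.
- by move=> a [x y] [x' y'] /= xy xy'; rewrite !linearPl /= xy xy'.
- exact: closed_dot_eq.
- exact: Euv.
Qed.

(** [G_dot_ind] is applied once in each argument of the form, which reduces the claim to pairs of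
    generators. *)
Let G_dot g h : G g -> G h -> dot g.1 h.1 = dot g.2 h.2.
Proof.
move=> Gg Gh; apply: G_dot_ind Gg => e Ee.
rewrite [LHS]dotC [RHS]dotC; congr (_^*)%R; apply: G_dot_ind Gh => f Ef.
by rewrite phi_dot.
Qed.

Let G_hnorm g : G g -> hnorm g.2 = hnorm g.1.
Proof.
move=> Gg; apply/eqP; rewrite -(eqrXn2 (n:=2)) ?hnorm_ge0//.
by apply/eqP/complexI; rewrite -!dotxx G_dot.
Qed.

Let G_fun x y y' : G (x, y) -> G (x, y') -> y = y'.
Proof.
move=> xy xy'; apply/subr0_eq/hnorm0_eq0.
by have /G_hnorm /= := GB xy xy'; rewrite subrr hnorm0.
Qed.

(** Completeness makes the domain closed. If first components converge, then by [G_hnorm] the second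
    components form a Cauchy sequence, and the limit pair is in [G] because [G] is closed. *)
Let G_dom : closed_subspace [set x | exists y, G (x, y)].
Proof.
split => /=; first by exists 0; exact: G0.
  by move=> a x y [x' xx'] [y' yy']; exists (a *: x' + y');
    exact: (GP a xx' yy').
move=> x clx.
have /choice[u uP] (k : nat) : exists g, G g /\ hnorm (x - g.1) < k.+1%:R^-1.
  have k0 : 0 < (k.+1%:R^-1)%:C :> R[i] by rewrite ltcR invr_gt0.
  have [z [[y zy]]] := clx _ (nbhsx_ballx x _ k0).
  by rewrite -ball_normE /= -hnormE ltcR => xz; exists (z, y).
have small (k : nat) : (k.+1%:R^-1) ^+ 2 <= k.+1%:R^-1 :> R.
  by rewrite expr2 ler_piMr ?invr_ge0// invf_le1// ler1n.
have uP2 (k : nat) : hnorm (x - (u k).1) ^+ 2 <= k.+1%:R^-1.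
  apply: le_trans (small k).
  by rewrite ler_pXn2r ?nnegrE ?hnorm_ge0 ?invr_ge0// ltW//; case: (uP k).
have [y uy] : exists y, (fun k => (u k).2) @ \oo --> y.
  apply: (@cauchy_seq_cvg _ 2) => // k l.
  have /G_hnorm /= -> := GB (proj1 (uP k)) (proj1 (uP l)).
  have := parallelogram (x - (u l).1) (x - (u k).1).
  have -> : x - (u l).1 - (x - (u k).1) = (u k).1 - (u l).1.
    by rewrite opprB addrC subrKA.
  have := uP2 k; have := uP2 l.
  (* The square of the sum in the parallelogram identity is dropped, which leaves the constant 2. *)
  have := sqr_ge0 (hnorm (x - (u l).1 + (x - (u k).1))).
  move: (hnorm _) (hnorm _) (hnorm _) (hnorm _) => a1 a2 a3 a4.
  by move: _^-1 _^-1 => b1 b2 *; lra.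
have ux : (fun k => (u k).1) @ \oo --> x.
  apply/cvgrPdist_lt => e e0.
  have [r er] : exists r, e = r%:C by apply/complex_realP; rewrite gtr0_real.
  have r0 : 0 < r by move: e0; rewrite er ltcR.
  have := near_infty_natSinv_lt (PosNum r0).
  apply: filterS => k /= kr; rewrite -hnormE er ltcR.
  by apply: lt_trans kr; case: (uP k).
exists y; apply: (closed_cvg G G_closed (F := \oo) (u_ := u)).
  by near=> k; case: (uP k).
have -> : u = fun k => ((u k).1, (u k).2) by apply/funext => k; case: (u k).
exact: cvg_pair ux uy.
Unshelve. all: by end_near. Qed.

Lemma isometry_extension :
  exists V, isometry_on (closed_span E) (closed_span (phi @` E)) V.
Proof.
pose V x := xget 0 [set y | G (x, y)].
have VG x : closed_span E x -> G (x, V x).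
  move=> Ex; have [y xy] : [set x | exists y, G (x, y)] x.
    apply: closed_span_sub Ex; first exact: G_dom.
    by move=> e Ee; exists (phi e) => S _ _ _; exact.
  by rewrite /V; case: xgetP => // /(_ y).
exists V; split.
- move=> x /VG Gx; apply: (Gx [set g | closed_span (phi @` E) g.2]) => /=.
  + by apply: csub0; exact: closed_subspace_closed_span.
  + by move=> a g h; apply: csubP; exact: closed_subspace_closed_span.
  + apply: preimage_closed;
    last by case: (closed_subspace_closed_span (phi @` E)).
    by move=> g _; exact: cvg_snd.
  + by move=> e Ee M [_]; apply; exists e.
- move=> a x y Ex Ey; apply: (@G_fun (a *: x + y));
  last exact: (GP a (VG _ Ex) (VG _ Ey)).
  by apply: VG; exact: (csubP (closed_subspace_closed_span E) a Ex Ey).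
- by move=> x /VG/G_hnorm.
Qed.

End IsometryExtension.

(** An injection from the basis of [M'] into that of [M] preserves inner products, since both bases
    are orthonormal. It therefore extends to the closed spans. *)
Lemma hdim_ge_isometry M M' :
  hdim_ge dot M M' -> exists V, isometry_on M' M V.
Proof.
move=> [E [E' [[_ oE <-] [_ oE' <-] /pcard_leP[f]]]].
have fE e : E' e -> E (f e) by exact: funS.
have [|V [VE VL Vn]] := @isometry_extension E' f.
  move=> e e' Ee Ee'; rewrite oE ?oE'//; try exact: fE.
  by rewrite (inj_in_eq (@inj _ _ _ f)) ?inE.
exists V; split => // x /VE; apply: closed_span_sub.
  exact: closed_subspace_closed_span.
by move=> _ [e Ee <-] N [_]; apply; exact: fE.
Qed.

Lemma isometry_on_comp M M' M'' V W : isometry_on M M' V ->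
  isometry_on M' M'' W -> isometry_on M M'' (W \o V).
Proof.
move=> [VM VL Vn] [WM WL Wn]; split => /=.
- by move=> x Mx; exact/WM/VM.
- by move=> a x y Mx My; rewrite VL// WL//; exact: VM.
- by move=> x Mx; rewrite Wn ?Vn//; exact: VM.
Qed.
Lemma isometry_on_id M : isometry_on M M id.
Proof. by []. Qed.

Lemma isometry_on0 M M' V : closed_subspace M -> isometry_on M M' V -> V 0 = 0.
Proof.
by move=> /csub0 M0 [_ _ Vn]; apply: hnorm0_eq0; rewrite Vn// hnorm0.
Qed.

Lemma isometry_proj_linear M M' V : closed_subspace M -> isometry_on M M' V ->
  linear (V \o proj M).
Proof.
move=> cM [_ VL _] a x y /=.
by rewrite proj_linear// VL//; exact: proj_in.
Qed.

Lemma hnorm_proj_le M x : closed_subspace M -> hnorm (proj M x) <= hnorm x.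
Proof.
move=> cM; rewrite -(ler_pXn2r (n:=2)) ?nnegrE ?hnorm_ge0//.
by rewrite (hnorm_proj cM x) lerDr sqr_ge0.
Qed.

Lemma linear_contraction_continuous (T : H -> H) :
  linear T -> (forall x, hnorm (T x) <= hnorm x) -> continuous T.
Proof.
move=> lT cT; apply: (@lipschitz_continuous _ _ _ _ 1) => // x y.
by rewrite -(linear_mapB lT) mul1r -!hnormE lecR.
Qed.

Lemma pythagoras_sum (I : finType) (P : pred I) (f : I -> H) :
  (forall i j, i != j -> dot (f i) (f j) = 0) ->
  hnorm (\sum_(i | P i) f i) ^+ 2 = \sum_(i | P i) hnorm (f i) ^+ 2.
Proof.
move=> of_; apply: complexI; rewrite -dotxx rmorph_sum linear_sumlz /=.
apply: eq_bigr => i Pi; rewrite linear_sumr /= (bigD1 i)//= big1 ?addr0.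
  by rewrite dotxx.
by move=> j /andP[_ ji]; rewrite of_// eq_sym.
Qed.

(** * Projections onto orthogonal differences *)

Section ProjOminus.
Variables (M M' : set H) (cM : closed_subspace M) (cM' : closed_subspace M').
Hypothesis M'M : M' `<=` M.

Lemma proj_ominus x : proj (ominus dot M M') x = proj M x - proj M' x.
Proof.
have in' y : M (proj M' y) by apply: M'M; exact: proj_in.
apply: proj_uniq; first exact: closed_subspace_ominus.
  split; first by apply: csubB => //; exact: proj_in.
  move=> y M'y; have -> : proj M x - proj M' x = (x - proj M' x) - (x - proj M
    x).
    by rewrite opprB [RHS]addrC subrKA.
  by rewrite linearBl /= !proj_orth// ?subrr//; exact: M'M.
move=> z [Mz zM']; rewrite opprB addrCA addrC linearDl /= proj_orth// add0r.
by apply/dot_eq0C/zM'; exact: proj_in.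
Qed.

(** In this form, sums over consecutive differences of a chain telescope. *)
Lemma hnorm_proj_ominus x : hnorm (proj (ominus dot M M') x) ^+ 2 =
  hnorm (proj M x) ^+ 2 - hnorm (proj M' x) ^+ 2.
Proof.
have cO := closed_subspace_ominus M' cM.
have [_ orth] := proj_in cO x; apply/eqP; rewrite eq_sym subr_eq -pythagoras.
  by rewrite proj_ominus subrK.
by apply: orth; exact: proj_in.
Qed.

End ProjOminus.

(** * The tree of differences and its row operator *)

Section Tree.
Variables (NN : set (set H)) (nestNN : nest NN) (n q : nat) (F : nat -> set H).
Hypothesis F_in : forall v, (v <= q)%N -> NN (F v).
Hypothesis F_sub : forall v w, (v <= w <= q)%N -> F w `<=` F v.

Local Notation E v := (ominus dot (F v) (F v.+1)).
(** For [a <= b <= q] this projects onto the orthogonal sum of the [E v] with [a <= v < b]. The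
    vertices of one depth form such an interval. *)
Local Notation block a b := (proj (ominus dot (F a) (F b))).

Hypothesis F_iso : forall v, (v.+1 < q)%N ->
  exists V, isometry_on (E v) (E v.+1) V.

Let F_closed v : (v <= q)%N -> closed_subspace (F v).
Proof. by case: nestNN => cN _ _ _ _ vq; exact/cN/F_in. Qed.

Let E_closed v w : (v <= q)%N -> closed_subspace (ominus dot (F v) (F w)).
Proof. by move=> vq; exact/closed_subspace_ominus/F_closed. Qed.

Let E_iso v w : (v <= w < q)%N -> exists V, isometry_on (E v) (E w) V.
Proof.
elim: w => [|w IH]; first by case: v => // _; exists id; exact: isometry_on_id.
case: (ltngtP v w.+1) => //= [vw|->] wq; last by exists id;
  exact: isometry_on_id.
have [|V VP] := IH; first by rewrite -ltnS vw ltnW.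
by have [W WP] := F_iso wq; exists (W \o V); exact: isometry_on_comp VP WP.
Qed.

Let block_id a b w y : (a <= w < b)%N -> (b <= q)%N -> E w y -> block a b y = y.
Proof.
move=> /andP[aw wb] bq [Fy oy]; apply: proj_id.
  by apply: E_closed; lia.
split; first by apply: F_sub Fy; lia.
by move=> z Fz; apply/oy/(F_sub _ Fz); lia.
Qed.

Let block_eq0 a b w y : ~~ (a <= w < b)%N -> (a <= b <= q)%N -> (w < q)%N ->
  E w y -> block a b y = 0.
Proof.
move=> wab abq wq [Fy oy]; apply: proj_eq0.
  by apply: E_closed; lia.
move=> z [Fz oz]; have [wa|aw] := ltnP w a.
  by apply: oy; apply: F_sub Fz; lia.
by apply/dot_eq0C/oz; apply: F_sub Fy; lia.
Qed.

(** Elements of the nest algebra preserve [F b], so what lies deeper than a block cannot influence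
    it. *)
Let block_F_eq0 a b y : (a <= b <= q)%N -> F b y -> block a b y = 0.
Proof.
move=> abq Fy; apply: proj_eq0; first by apply: E_closed; lia.
by move=> z [_ oz]; exact/dot_eq0C/oz.
Qed.

Let E_orth u w x y : u != w -> (u < q)%N -> (w < q)%N -> E u x -> E w y ->
  dot x y = 0.
Proof.
wlog uw : u w x y / (u < w)%N => [wlog_uw|] uw' uq wq.
  move: (uw'); rewrite neq_ltn => /orP[?|?] Ex Ey; first exact: (wlog_uw u w).
  by apply/dot_eq0C/(wlog_uw w u) => //; rewrite eq_sym.
by move=> [_ ox] [Fy _]; apply: ox; apply: F_sub Fy; lia.
Qed.

Let hnorm_block a b x : (a <= b <= q)%N -> hnorm (block a b x) ^+ 2 =
  hnorm (proj (F a) x) ^+ 2 - hnorm (proj (F b) x) ^+ 2.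
Proof.
move=> abq.
by apply: hnorm_proj_ominus; [apply: F_closed|apply: F_closed|apply: F_sub];
  lia.
Qed.

Let sum_hnorm_block a b x : (a <= b <= q)%N ->
  \sum_(a <= v < b) hnorm (block v v.+1 x) ^+ 2 = hnorm (block a b x) ^+ 2.
Proof.
move=> abq; rewrite hnorm_block//.
rewrite (@eq_big_nat _ _ _ _ _ _ (fun v => - hnorm (proj (F v.+1) x) ^+ 2 -
    - hnorm (proj (F v) x) ^+ 2)).
  by rewrite telescope_sumr ?opprK 1?addrC//; lia.
by move=> v vab; rewrite hnorm_block ?opprK 1?addrC//; lia.
Qed.

Variable m : nat.
Hypothesis q_level : q = level n m.+1.

Let q_child : q = (n * level n m).+1.
Proof. by rewrite q_level levelS. Qed.

(* The vertices [0, ..., q - 1] form a complete [n]-ary tree: the children of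
   [v] are [n * v + 1, ..., n * v + n] and the vertices of depth [k] are those
   in [level n k, level n k.+1). *)
Let child (v i : nat) := (n * v + i).+1.

Let child_inj v v' i i' : (i < n)%N -> (i' < n)%N ->
  child v i = child v' i' -> v = v' /\ i = i'.
Proof.
move=> iN i'N [] vi; have n0 : (0 < n)%N by lia.
have := congr1 (divn^~ n) vi; have := congr1 (modn^~ n) vi.
by rewrite !(mulnC n) !modnMDl !divnMDl// !modn_small// !divn_small// !addn0.
Qed.

Let child_lt v i : (v < level n m)%N -> (i < n)%N -> (child v i < q)%N.
Proof. by rewrite q_child /child => vm iN; nia. Qed.

Let child_gt v i : (i < n)%N -> (v < child v i)%N.
Proof. by rewrite /child => iN; nia. Qed.

(** Since [level n k.+1] is [n * level n k + 1] and [i < n], both bounds descend to the parent on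
    division by [n]. *)
Let child_level k v i : (i < n)%N ->
  (level n k.+1 <= child v i < level n k.+2)%N =
  (level n k <= v < level n k.+1)%N.
Proof.
rewrite /child !levelS !ltnS => iN; congr andb.
  apply/idP/idP => h; last by nia.
  by rewrite leqNgt; apply/negP => vk; nia.
by apply/idP/idP => h; nia.
Qed.

Lemma tree_operator : exists A : 'I_n -> H -> H,
  [/\ entries_in (nest_algebra NN) A,
      (row_norm A <= 1%:E)%E,
      forall x : 'I_n -> H, block (level n 0) (level n 1) (row_op A x) = 0
    & forall k (x : 'I_n -> H), (k < m)%N ->
        hnorm (block (level n k.+1) (level n k.+2) (row_op A x)) ^+ 2 =
        \sum_(i < n) hnorm (block (level n k) (level n k.+1) (x i)) ^+ 2].
Proof.
have /choice[W WP] (c : nat * nat) : exists V,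
    (c.1 <= c.2 < q)%N -> isometry_on (E c.1) (E c.2) V.
  (* Outside the admissible pairs [id] is a dummy value, so that [choice] yields a total family
     [W]. *)
  have [cq|_] := boolP (c.1 <= c.2 < q)%N; last by exists id.
  by have [V VP] := E_iso cq; exists V.
pose T v i := W (v, child v i) \o block v v.+1.
have {}WP v i : (v < level n m)%N -> (i < n)%N ->
    isometry_on (E v) (E (child v i)) (W (v, child v i)).
  move=> vm iN; apply: (WP (v, child v i)) => /=.
  by rewrite child_lt// ltnW// child_gt.
have vq v : (v < level n m)%N -> (v <= q)%N.
  by move=> vm; rewrite q_level ltnW// (leq_trans vm)// level_le.
have level_m : (level n m <= q)%N by rewrite q_level level_le.
have T_in v i x : (v < level n m)%N -> (i < n)%N -> E (child v i) (T v i x).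
  move=> vm iN; have [WE _ _] := WP _ _ vm iN; apply: WE.
  by apply: proj_in; exact/E_closed/vq.
have T_hnorm v i x : (v < level n m)%N -> (i < n)%N ->
    hnorm (T v i x) = hnorm (block v v.+1 x).
  by move=> vm iN; have [_ _ ->//] := WP _ _ vm iN; apply: proj_in;
    exact/E_closed/vq.
have T_linear v i : (v < level n m)%N -> (i < n)%N -> linear (T v i).
  by move=> vm iN; apply: isometry_proj_linear (WP _ _ vm iN);
    apply/E_closed/vq.
(* The sum stops at [level n m] because the vertices of depth [m] are leaves. *)
pose A (i : 'I_n) x := \sum_(v < level n m) T v i x.
have rowE (x : 'I_n -> H) : row_op A x =
    \sum_(c : 'I_n * 'I_(level n m)) T c.2 c.1 (x c.1).
  by rewrite /row_op /A pair_bigA.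
have T_orth (x : 'I_n -> H) (c d : 'I_n * 'I_(level n m)) : c != d ->
    dot (T c.2 c.1 (x c.1)) (T d.2 d.1 (x d.1)) = 0.
  move=> cd; apply: (@E_orth (child c.2 c.1) (child d.2 d.1)).
  - apply: contraNneq cd => /child_inj[]// vE iE.
    by rewrite -pair_eqE /pair_eq -!val_eqE /= vE iE !eqxx.
  - exact: child_lt.
  - exact: child_lt.
  - exact: T_in.
  - exact: T_in.
have A_linear i : linear (A i).
  move=> a x y; rewrite /A scaler_sumr -big_split /=; apply: eq_bigr => v _.
  by rewrite T_linear.
(* The ranges of the [T v i] are pairwise orthogonal, so Pythagoras evaluates any interval of
   vertices. The full interval gives contractivity and a single depth gives the depth shift. *)
have hnorm_part a b (x : 'I_n -> H) : (a <= b <= level n m)%N ->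
    hnorm (\sum_(c : 'I_n * 'I_(level n m) | (a <= c.2 < b)%N)
      T c.2 c.1 (x c.1)) ^+ 2 = \sum_(i < n) hnorm (block a b (x i)) ^+ 2.
  move=> /andP[ab bm]; rewrite pythagoras_sum; last exact: T_orth.
  under eq_bigr do rewrite T_hnorm//.
  rewrite -(pair_big xpredT (fun v : 'I_ _ => (a <= v < b)%N)
    (fun i v => hnorm (block v v.+1 (x i)) ^+ 2)) /=.
  apply: eq_bigr => i _;
    rewrite -sum_hnorm_block ?ab ?(leq_trans bm) ?level_m//.
  rewrite (big_nat_widen _ _ _ _ _ bm) (big_nat_widenl _ 0)// big_mkord.
  by apply: eq_bigl => v; rewrite andbC.
have hnorm_row (x : 'I_n -> H) : hnorm (row_op A x) ^+ 2 =
    \sum_(i < n) hnorm (block 0 (level n m) (x i)) ^+ 2.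
  rewrite -hnorm_part ?leqnn// rowE; congr (hnorm _ ^+ 2).
  by apply: eq_bigl => c; rewrite ltn_ord.
have block_row a b (x : 'I_n -> H) : (a <= b <= q)%N ->
    block a b (row_op A x) =
    \sum_(c : 'I_n * 'I_(level n m) | (a <= child c.2 c.1 < b)%N)
      T c.2 c.1 (x c.1).
  move=> abq; have /andP[ab bq] := abq.
  rewrite rowE linear_map_sum;
    last by apply/proj_linear/E_closed/(leq_trans ab).
  rewrite [RHS]big_mkcond /=; apply: eq_bigr => c _; case: ifPn => cab.
    by apply: block_id cab bq _; exact: T_in.
  by apply: block_eq0 cab abq _ _; [exact: child_lt|exact: T_in].
exists A; split.
- move=> i; split => //.
    apply: linear_contraction_continuous => // x.
    rewrite -(ler_pXn2r (n:=2)) ?nnegrE ?hnorm_ge0//.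
    rewrite /A pythagoras_sum => [|v w vw]; last first.
      by apply: (T_orth (fun=> x) (i, v) (i, w)); apply: contraNneq vw => -[->].
    under eq_bigr do rewrite T_hnorm//.
    rewrite -(big_mkord xpredT (fun v => hnorm (block v v.+1 x) ^+ 2)).
    rewrite sum_hnorm_block ?level_m// ler_pXn2r ?nnegrE ?hnorm_ge0//.
    by apply: hnorm_proj_le; exact: E_closed.
  move=> M NM _ [x Mx <-]; case: nestNN => nclosed ntotal _ _ _.
  apply: csub_sum => [|v _]; first exact: nclosed.
  have vlq : (v < q)%N by rewrite (leq_trans (ltn_ord v)) ?level_m.
  (* If [M] lies in [F v.+1], the block at [v] kills it. Otherwise [M] contains [F v.+1], hence the
     range of [T v i], because a child has a larger number than its parent. *)
  have [MF|FM] := ntotal M (F v.+1) NM (F_in vlq).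
    rewrite /T /= proj_eq0; last 2 first.
    + exact/E_closed/ltnW.
    + by move=> z [_ oz]; exact/dot_eq0C/oz/MF.
    rewrite (isometry_on0 _ (WP v i _ _))//; first exact: csub0 (nclosed _ NM).
    exact/E_closed/ltnW.
  apply: FM; have [Fc _] := T_in v i x (ltn_ord v) (ltn_ord i).
  apply: F_sub Fc; rewrite child_gt// ltnW//; exact: child_lt.
- apply/ereal_supP => _ [x x1 <-]; rewrite lee_fin.
  rewrite -(ler_pXn2r (n:=2)) ?nnegrE ?hnorm_ge0// hnorm_row.
  apply: (@le_trans _ _ (hnormn x ^+ 2)).
    rewrite hnormn_sqr; apply: ler_sum => i _.
    rewrite ler_pXn2r ?nnegrE ?hnorm_ge0//.
    by apply: hnorm_proj_le; exact: E_closed.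
  by rewrite ler_pXn2r ?nnegrE ?sqrtr_ge0.
- move=> x; rewrite block_row; last by rewrite level_le//= q_level level_le.
  (* The root 0 is nobody's child. *)
  by rewrite big_pred0// => c; rewrite levelS level0 muln0 ltnS ltn0 andbF.
- move=> k x km; rewrite block_row; last by rewrite !(level_le, q_level).
  rewrite -hnorm_part; last by rewrite !level_le.
  congr (hnorm _ ^+ 2); apply: eq_bigl => c; exact: child_level.
Qed.

(** At each depth the blocks of $Az$ and $Bz$ are compared on truncations of $z=Cx$, which gives the
    hypotheses of [geometric_growth]. *)
Lemma tree_lower_bound (A B C : 'I_n -> H -> H) (t : R) (x : H) :
  0 < t -> t <= 1 / 4 ->
  entries_in (nest_algebra NN) A ->
  (forall y : 'I_n -> H, block (level n 0) (level n 1) (row_op A y) = 0) ->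
  (forall k (y : 'I_n -> H), (k < m)%N ->
     hnorm (block (level n k.+1) (level n k.+2) (row_op A y)) ^+ 2 =
     \sum_(i < n) hnorm (block (level n k) (level n k.+1) (y i)) ^+ 2) ->
  entries_in (nest_algebra NN) B ->
  entries_in (nest_algebra NN) C ->
  (row_norm (fun i y => A i y - B i y)%R < t%:E)%E ->
  row_op B \o col_op C = id -> E 0 x -> hnorm x = 1 ->
  (1 - 2 * t) ^+ m * t ^- m.+1 <= hnormn (col_op C x).
Proof.
move=> t0 t4 nA A0 Ak nB nC ABt BC Ex x1.
pose z i := C i x; have rowBz : row_op B z = x by have := congr1 (@^~ x) BC.
(* Invariance of [F 0] under [C] leaves [z] no component outside [F 0], so the telescoping sum
   starts from the full norm. *)
have Fz i : F 0 (z i).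
  by have [_ _ /(_ _ (F_in (leq0n q)))] := nC i; apply; exists x => //;
    case: Ex.
have levelq k : (k <= m.+1)%N -> (level n k <= q)%N.
  by move=> km; rewrite q_level level_le.
have level2q k : (k <= m)%N -> (level n k <= level n k.+1 <= q)%N.
  by move=> km; rewrite level_le//= levelq.
pose b k := \sum_(i < n) hnorm (block (level n k) (level n k.+1) (z i)) ^+ 2.
(* This keeps the part of [z] at depths at most [k]. It also discards the component in [F q], below
   the whole tree. *)
pose z' k i := z i - proj (F (level n k.+1)) (z i).
have z'_sum k : (k <= m)%N ->
    \sum_(i < n) hnorm (z' k i) ^+ 2 = \sum_(j < k.+1) b j.
  move=> km; rewrite exchange_big /=; apply: eq_bigr => i _.
  transitivity (hnorm (z i) ^+ 2 - hnorm (proj (F (level n k.+1)) (z i)) ^+ 2).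
    by rewrite (hnorm_proj (F_closed (levelq k.+1 km)) (z i)) addrK.
  rewrite -(big_mkord xpredT
    (fun j => hnorm (block (level n j) (level n j.+1) (z i)) ^+ 2)).
  rewrite (@eq_big_nat _ _ _ _ _ _ (fun j =>
    - hnorm (proj (F (level n j.+1)) (z i)) ^+ 2 -
    - hnorm (proj (F (level n j)) (z i)) ^+ 2)); last first.
    move=> j /andP[_ jk]; rewrite hnorm_block ?opprK 1?addrC//.
    by apply: level2q; rewrite -ltnS (leq_trans jk).
  rewrite telescope_sumr// opprK addrC level0.
  by rewrite (proj_id (F_closed (leq0n q)) (Fz i)).
have blockD k : (k <= m)%N -> hnorm (block (level n k) (level n k.+1)
    (row_op A (z' k)) - block (level n k) (level n k.+1) x) ^+ 2 <=
    t ^+ 2 * \sum_(j < k.+1) b j.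
  move=> km; have bl := proj_linear (E_closed (level n k.+1) (levelq k (leqW
    km))).
  (* Truncating [z] changes [row_op B z = x] only by a vector of [F (level n k.+1)], which the block
     at depth [k] kills. *)
  have -> : block (level n k) (level n k.+1) x =
      block (level n k) (level n k.+1) (row_op B (z' k)).
    have -> : row_op B (z' k) = x - row_op B (fun i => proj (F (level n k.+1))
      (z i)).
      rewrite -{1}rowBz /row_op -sumrB; apply: eq_bigr => i _.
      by have [lB _ _] := nB i; rewrite linear_mapB.
    rewrite linear_mapB// [X in _ - X]block_F_eq0 ?subr0 ?level2q//.
    apply: csub_sum => [|i _]; first exact/F_closed/levelq.
    have [_ _ /(_ _ (F_in (levelq k.+1 km)))] := nB i; apply.
    by exists (proj (F (level n k.+1)) (z i)) => //; apply: proj_in;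
      exact/F_closed/levelq.
  rewrite -linear_mapB// -z'_sum//.
  apply: le_trans (row_norm_bound (z' k) _ ABt).
    rewrite /row_op sumrB ler_pXn2r ?nnegrE ?hnorm_ge0//.
    by apply: hnorm_proj_le; apply: E_closed; exact/levelq/leqW.
  move=> i a u v; have [lA _ _] := nA i; have [lB _ _] := nB i.
  by rewrite lA lB opprD addrACA -scalerBr.
(* At depth 0 the row [A] contributes nothing and [x] is its own block. *)
have b1 : 1 <= t ^+ 2 * b 0%N.
  have := blockD 0%N isT; rewrite A0 sub0r hnormN big_ord1.
  rewrite (@block_id _ _ 0%N) ?x1 ?expr1n//; first by rewrite levelS level0.
  exact: levelq.
(* At depth [k.+1] the vector [x] contributes nothing, and [A] shifts up the depth [k] part, which
   truncation at depth [k.+1] leaves unchanged. *)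
have bS k : (k.+1 < m.+1)%N -> b k <= t ^+ 2 * \sum_(j < k.+2) b j.
  rewrite ltnS => km; apply: le_trans (blockD k.+1 km).
  rewrite (@block_eq0 _ _ 0%N x) ?level2q//; last 2 first.
  - by rewrite levelS.
  - by rewrite q_child.
  rewrite subr0 Ak//; apply: ler_sum => i _.
  rewrite /z' linear_mapB; last by apply/proj_linear/E_closed/levelq/leqW/ltnW.
  rewrite [X in _ - X]block_F_eq0 ?subr0// ?level2q ?(ltnW km)//.
  apply: (@F_sub _ (level n k.+2)); first exact: level2q.
  by apply: proj_in; exact/F_closed/levelq.
have b0 k : 0 <= b k by apply: sumr_ge0 => i _; exact: sqr_ge0.
have bm := geometric_growth t0 t4 b0 b1 bS (ltnSn m).
rewrite -(ler_pXn2r (n:=2)) ?nnegrE ?sqrtr_ge0//; last first.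
  by rewrite mulr_ge0 ?invr_ge0 ?exprn_ge0 ?(ltW t0)//; lra.
apply: le_trans bm _; rewrite hnormn_sqr; apply: ler_sum => i _.
rewrite ler_pXn2r ?nnegrE ?hnorm_ge0//; apply: hnorm_proj_le.
exact/E_closed/levelq.
Qed.

End Tree.

(** * Unit vectors in differences, and assembly of the bound *)

Lemma unit_vector_ominus M M' :
  closed_subspace M -> closed_subspace M' -> M' `<` M ->
  exists2 x, ominus dot M M' x & hnorm x = 1.
Proof.
move=> cM cM' [M'M MM'].
have [y [My M'y]] : exists y, M y /\ ~ M' y.
  by apply: contra_notP MM' => /forallNP h y My; apply: contrapT => M'y;
    apply: (h y).
pose u := y - proj M' y.
have u0 : hnorm u != 0.
  apply/eqP => /hnorm0_eq0/subr0_eq yE; apply: M'y; rewrite yE; exact: proj_in.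
exists ((hnorm u)^-1%:C *: u); last first.
  by rewrite hnormZr ger0_norm ?mulVf// invr_ge0 hnorm_ge0.
apply: (csubZ (closed_subspace_ominus M' cM)); split.
  by apply: csubB => //; apply: M'M; exact: proj_in.
exact: proj_orth.
Qed.

End Inner.
End HilbertSpaceTheory.

Theorem theorem5p4 (R : realType) (H : completeNormedModType R[i])
    (dot : {dot H for Num.conj}) (dotE : forall x : H, dot x x = `|x| ^+ 2)
    (NN : set (set H)) (nestNN : nest NN)
    (n p q : nat) (n_ge2 : (2 <= n)%N) (p_ge1 : (1 <= p)%N)
    (qE : q = ((n ^ p - 1) %/ (n - 1))%N)
    (N : nat -> set H)
    (N_in : forall j : nat, (j <= q)%N -> NN (N j))
    (N_lt : forall j : nat, (j < q)%N -> N j `<` N j.+1)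
    (N_dim : forall j : nat, (1 <= j < q)%N ->
       hdim_ge dot (ominus dot (N j) (N j.-1)) (ominus dot (N j.+1) (N j)))
    (t : R) (t_gt0 : 0 < t) (t_le : t <= 1 / 4) :
  (((1 - 2 * t) ^+ (p - 1) * t ^- p)%:E <= rho n (nest_algebra NN) t)%E /\
  2 ^+ p <= (1 - 2 * t) ^+ (p - 1) * t ^- p.
Proof.
case: p p_ge1 qE => // m _ qE.
have {qE} q_level : q = level n m.+1.
  by rewrite qE !subn1 predn_exp mulKn// -ltnS prednK// ltnW.
have q0 : (0 < q)%N by rewrite q_level levelS.
(* The reversal makes dimensions grow with the vertex number, so that each [E_v] embeds in its
   successor. *)
pose F v := N (q - v)%N.
have F_in v : (v <= q)%N -> NN (F v) by move=> _; apply: N_in; exact: leq_subr.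
have N_sub i j : (i <= j <= q)%N -> N i `<=` N j.
  move=> /andP[/subnK <-]; elim: (j - i)%N => [|d IH] dq x Nx //.
  by have [+ _] := N_lt (d + i)%N dq; apply; exact: IH (ltnW dq) _ Nx.
have F_sub v w : (v <= w <= q)%N -> F w `<=` F v.
  by move=> vwq; apply: N_sub; lia.
have F_iso v : (v.+1 < q)%N -> exists V,
    isometry_on (ominus dot (F v) (F v.+1)) (ominus dot (F v.+1) (F v.+2)) V.
  move=> vq; apply: (hdim_ge_isometry dotE).
  (* With [j = q - v.+1] the larger difference in the hypothesis is that of vertex [v.+1] and the
     smaller that of [v]. *)
  have := N_dim (q - v.+1)%N; rewrite /F.
  have -> : (q - v.+1).-1 = (q - v.+2)%N by lia.
  have -> : (q - v.+1).+1 = (q - v)%N by lia.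
  by apply; lia.
rewrite subn1 /=; split; last first.
  (* The bound is the product of [m] factors [(1 - 2 * t) / t] and one factor [t^-1], each at least
     2. *)
  have r2 : 2 <= (1 - 2 * t) / t by rewrite ler_pdivlMr//; lra.
  have tm : 2 ^+ m <= ((1 - 2 * t) / t) ^+ m.
    by rewrite lerXn2r ?nnegrE//; apply: le_trans r2.
  have t2 : 2 <= t^-1 by rewrite -[2]invrK lef_pV2 ?posrE ?invr_gt0//; lra.
  rewrite exprSr [t ^+ m.+1]exprSr invfM mulrA.
  rewrite expr_div_n in tm.
  by rewrite ler_pM ?exprn_ge0.
have [A [nA rA A0 Ak]] := tree_operator dotE nestNN F_in F_sub F_iso q_level.
have [nclosed _ _ _ _] := nestNN.
have [x Ex x1] : exists2 x, ominus dot (F 0%N) (F 1%N) x & hnorm x = 1.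
  apply: (unit_vector_ominus dotE); try exact/nclosed/F_in.
  have := N_lt q.-1; rewrite /F subn0 subn1 prednK//; apply.
  by rewrite leqnn.
apply: (@le_trans _ _ (rho_row (nest_algebra NN) A t)); last first.
  by apply: ereal_sup_ubound; exists A.
(* Bounding every admissible [C] also covers the case where there is none and the infimum is
   infinite. *)
apply/ereal_infP => _ [C [nC [B [nB ABt BC]]] <-].
apply: (@le_trans _ _ (hnormn (col_op C x))%:E); last first.
  by apply: ereal_sup_ubound; exists x => //=; rewrite x1.
rewrite lee_fin.
exact: (tree_lower_bound dotE nestNN F_in F_sub q_level t_gt0 t_le nA A0 Ak nB
  nC ABt BC Ex x1).
Qed.
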